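(* Let $\mathsf P$ be a special subalgebra of a cubic algebra $\mathcal L$. Then the set of $\mathsf P$-Boolean special subalgebras, ordered by reverse inclusion, is a Boolean algebra in which the meet is $\vee$, the join is $\cap$, the top element is $\{\mathbf 1\}$, the bottom element is $\mathsf P$, and the complement of $\mathsf Q$ is $\mathsf Q\to\mathsf P$.
   Context: A cubic algebra is a join-semilattice $\mathcal L$ with top $\mathbf 1$ and a binary operation $\Delta$ such that: if $x\le y$ then $\Delta(y,x)\vee x=y$; if $x\le y\le z$ then $\Delta(z,\Delta(y,x))=\Delta(\Delta(z,y),\Delta(z,x))$; if $x\le y$ then $\Delta(y,\Delta(y,x))=x$; if $x\le y\le z$ then $\Delta(z,x)\le\Delta(z,y)$; and with $xy:=\Delta(\mathbf 1,\Delta(x\vee y,y))\vee y$ one has $(xy)y=x\vee y$ and $x(yz)=y(xz)$. With $xy$, $\mathcal L$ is an implication algebra; an implication subalgebra is a subset closed under it. A subset $A$ is compatible iff $x\vee\Delta(\mathbf 1,y)=\mathbf 1$ for all $x,y\in A$ (equivalently, its image under every embedding into an interval algebra of a Boolean algebra has the finite intersection property). A special subalgebra is an upwards-closed, compatible implication subalgebra $I$ with $x\wedge y\in I$ whenever $x,y\in I$ and $x\wedge y$ exists in $\mathcal L$. For special subalgebras $\mathsf H,\mathsf K$ with $\mathsf H\cup\mathsf K$ compatible, $\mathsf H\vee\mathsf K$ is the smallest special subalgebra containing $\mathsf H\cup\mathsf K$. For special subalgebras $\mathsf Q\subseteq\mathsf P$, $\mathsf Q\to\mathsf P=\{h\in\mathsf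 P: h\vee g=\mathbf 1\ \forall g\in\mathsf Q\}$. A special subalgebra $\mathsf Q$ is $\mathsf P$-Boolean iff $\mathsf Q\subseteq\mathsf P$ and $\mathsf Q\vee(\mathsf Q\to\mathsf P)=\mathsf P$. *)

(* Defs.v *)
From HB Require Import structures.
From mathcomp Require Import all_boot all_order.
From mathcomp Require Import boolp classical_sets.

Set Implicit Arguments.
Unset Strict Implicit.
Unset Printing Implicit Defensive.

Import Order.TTheory.
Local Open Scope classical_set_scope.
Local Open Scope order_scope.

(* The product [xy], parametrized by the operation so that it can occur in the
   axioms of cubic algebras. *)
Definition imp_of d (L : tJoinSemilatticeType d) (D : L -> L -> L) (x y : L) :
  L := (D \top (D (x `|` y) y) `|` y)%O.

HB.mixin Record isCubic (d : Order.disp_t) L of Order.TJoinSemilattice d L := {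
  Delta : L -> L -> L;
  Delta_join : forall x y : L, x <= y -> (Delta y x `|` x)%O = y;
  DeltaD : forall x y z : L, x <= y -> y <= z ->
    Delta z (Delta y x) = Delta (Delta z y) (Delta z x);
  DeltaK : forall x y : L, x <= y -> Delta y (Delta y x) = x;
  Delta_mono : forall x y z : L, x <= y -> y <= z -> Delta z x <= Delta z y;
  imp_ofK : forall x y : L, imp_of Delta (imp_of Delta x y) y = (x `|` y)%O;
  imp_ofCA : forall x y z : L,
    imp_of Delta x (imp_of Delta y z) = imp_of Delta y (imp_of Delta x z)
}.

#[short(type="cubicType")]
HB.structure Definition Cubic (d : Order.disp_t) :=
  { L of isCubic d L & Order.TJoinSemilattice d L }.

Section CubicAlgebra.
Variables (d : Order.disp_t) (L : cubicType d).
Implicit Types (x y m : L) (A H K P Q : set L).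

Definition imp x y : L := imp_of Delta x y.

(* Subalgebras are nonempty, as usual in universal algebra; equivalently, they
   contain the constant 1 = xx of the implication algebra. *)
Definition imp_subalgebra A : Prop :=
  A !=set0 /\ forall x y, A x -> A y -> A (imp x y).

Definition upwards_closed A : Prop := forall x y, A x -> x <= y -> A y.

Definition compatible A : Prop :=
  forall x y, A x -> A y -> (x `|` Delta \top y)%O = \top.

(* [m] is the meet of [x] and [y] in [L], where meets need not exist. *)
Definition is_meet x y m : Prop :=
  [/\ m <= x, m <= y & forall z : L, z <= x -> z <= y -> z <= m].

Definition special A : Prop :=
  [/\ imp_subalgebra A, upwards_closed A, compatible A
    & forall x y m, A x -> A y -> is_meet x y m -> A m].

(* The intersection of all special subalgebras containing [H] and [K]; it is
   only meaningful (and only used) when the union of [H] and [K] is compatible,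
   as otherwise there is no such subalgebra. *)
Definition special_join H K : set L := smallest special (H `|` K).

Definition special_imp Q P : set L :=
  [set h | P h /\ forall g, Q g -> (h `|` g)%O = \top].

Definition is_boolean P Q : Prop :=
  [/\ special Q, Q `<=` P & special_join Q (special_imp Q P) = P].

Definition boolean_special P : Type := {Q : set L | is_boolean P Q}.

End CubicAlgebra.

(* [boolean_algebra T] is the type of Boolean algebra structures with carrier
   [T]; the display only affects printing. *)
Definition boolean_algebra (T : Type) : Type :=
  Order.CTBDistrLattice.axioms_ (Order.Disp tt tt) T.

Definition boolean_pack (T : Type) (c : boolean_algebra T) :
  ctbDistrLatticeType (Order.Disp tt tt) := Order.CTBDistrLattice.Pack c.

(* Main.v *)
(* Under imp, a cubic algebra satisfies the laws of a commutative BCK-algebra,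
   which already suffice for the following: two elements with a common lower
   bound have a meet, and joining with a fixed element preserves existing
   meets.  Hence, for special H, K contained in P, the set of all existing
   meets of an h in H and a k in K is special, and is therefore the join of H
   and K.  It follows that the special subalgebras contained in P form a
   bounded distributive lattice.  The P-Boolean ones are its complemented
   elements, and these form a Boolean algebra. *)
Require Import Defs.
From HB Require Import structures.
From mathcomp Require Import all_boot all_order.
From mathcomp Require Import boolp classical_sets.

Set Implicit Arguments.
Unset Strict Implicit.
Unset Printing Implicit Defensive.

Import Order.TTheory.
Local Open Scope classical_set_scope.
Local Open Scope order_scope.

(** * Order-theoretic laws of [imp] and of existing meets *)

Section Implication.
Context (d : Order.disp_t) (L : cubicType d).
Implicit Types a b c m w x y z : L.

Lemma Delta_id x : Delta x x = x.
Proof.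
have le_x : Delta x x <= x by rewrite -{3}(Delta_join x x (lexx x)) leUl.
apply: le_anti; rewrite le_x /=.
(* Applying the monotone involution [Delta x] to [Delta x x <= x] gives the reverse inequality. *)
by rewrite -{1}(DeltaK x x (lexx x)); apply: Delta_mono.
Qed.

Lemma impE_le x y : y <= x -> imp x y = (Delta \top (Delta x y) `|` y)%O.
Proof. by move=> yx; rewrite /imp /imp_of (join_l yx). Qed.

Lemma impK x y : imp (imp x y) y = (x `|` y)%O.
Proof. exact: imp_ofK. Qed.

Lemma impCA x y z : imp x (imp y z) = imp y (imp x z).
Proof. exact: imp_ofCA. Qed.

Lemma le_imp x y : y <= imp x y.
Proof. exact: leUr. Qed.

Lemma imp1x x : imp \top x = x.
Proof. by rewrite impE_le ?lex1// DeltaK ?lex1// joinxx. Qed.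

Lemma impxx x : imp x x = \top.
Proof. by rewrite impE_le// Delta_id Delta_join ?lex1. Qed.

Lemma imp_eq1 x y : imp x y = \top <-> x <= y.
Proof.
split=> [xy1|xy]; first by rewrite -[leRHS]imp1x -xy1 impK leUl.
by rewrite /imp /imp_of (join_r xy) -[RHS](impxx y) /imp /imp_of joinxx.
Qed.

(** Both sides say that an iterated [imp] equals [\top], and [impCA] exchanges the premises. Thus
    [imp^~ y] forms an antitone Galois connection with itself. *)
Lemma le_impC w x y : (w <= imp x y) = (x <= imp w y).
Proof. by apply/idP/idP => /imp_eq1 h; apply/imp_eq1; rewrite impCA. Qed.

Lemma imp_antitone x y z : x <= y -> imp y z <= imp x z.
Proof. by move=> xy; rewrite le_impC impK (le_trans xy)// leUl. Qed.

(** Writing [y] as [imp (imp y x) x] and exchanging premises turns [imp z y] into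
    [imp (imp y x) (imp z x)]. *)
Lemma imp_monotone x y z : x <= y -> imp z x <= imp z y.
Proof.
by move=> xy; rewrite -(join_l xy) -impK impCA le_imp.
Qed.

Lemma imp_invol x m : m <= x -> imp (imp x m) m = x.
Proof. by move=> mx; rewrite impK (join_l mx). Qed.

Lemma le_imp_join w x y z :
  w <= imp x z -> w <= imp y z -> w <= imp (x `|` y)%O z.
Proof. by rewrite 3!(le_impC w) => xz yz; rewrite leUx xz. Qed.

Lemma is_meet_uniq a b m n : is_meet a b m -> is_meet a b n -> m = n.
Proof.
by move=> [ma mb mP] [na nb nP]; apply: le_anti; rewrite nP// mP.
Qed.

Lemma is_meet11 m : is_meet (\top : L) \top m -> m = \top.
Proof. by case=> _ _ h; apply/eqP; rewrite -le1x h. Qed.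

(* De Morgan in the interval above the common lower bound [c], on which
   [imp^~ c] is an order-reversing involution. *)
Lemma is_meet_imp a b c : c <= a -> c <= b ->
  is_meet a b (imp (imp a c `|` imp b c)%O c).
Proof.
move=> ca cb; split.
- by rewrite -[leRHS](imp_invol ca) imp_antitone// leUl.
- by rewrite -[leRHS](imp_invol cb) imp_antitone// leUr.
- by move=> z za zb; apply: le_imp_join; rewrite impK lexU2// ?za ?zb.
Qed.

(** Each of [a], [b], [m] has the form [imp u m]. Exchange turns [imp z (imp u m)] into
    [imp u (imp z m)], where [le_imp_join] applies. *)
Lemma imp_is_meet a b m w z :
  is_meet a b m -> w <= imp z a -> w <= imp z b -> w <= imp z m.
Proof.
move=> abm; have [ma mb _] := abm.
rewrite -[in imp z a](imp_invol ma) -[in imp z b](imp_invol mb) => wa wb.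
rewrite (is_meet_uniq abm (is_meet_imp ma mb)) impCA.
by apply: le_imp_join; rewrite impCA.
Qed.

Lemma is_meet_join a b m c :
  is_meet a b m -> is_meet (a `|` c)%O (b `|` c)%O (m `|` c)%O.
Proof.
move=> abm; have [ma mb _] := abm.
split=> [||z za zb]; rewrite ?leU2//.
(* The join of [c] and [m] is [imp (imp c m) m], so the goal becomes [imp c m <= imp z m], which can
   be tested on [a] and [b]. *)
rewrite joinC -impK le_impC; apply: (imp_is_meet abm).
  by rewrite (le_trans (imp_monotone c ma))// le_impC impK joinC.
by rewrite (le_trans (imp_monotone c mb))// le_impC impK joinC.
Qed.

End Implication.

(** * Special subalgebras, their joins and relative complements *)

Section Special.
Context (d : Order.disp_t) (L : cubicType d).
Implicit Types (a b m x y z : L) (H K M P Q R : set L).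

Lemma special_up Q x y : special Q -> Q x -> x <= y -> Q y.
Proof. by case=> _ + _ _; apply. Qed.

Lemma special_meet Q x y m : special Q -> Q x -> Q y -> is_meet x y m -> Q m.
Proof. by case=> _ _ _; apply. Qed.

Lemma special1 Q : special Q -> Q \top.
Proof.
by move=> sQ; have [[[x Qx] _] _ _ _] := sQ; apply: special_up Qx (lex1 x).
Qed.

(** Compatibility passes to subsets, and an upwards closed set is closed under [imp] because
    [y <= imp x y]. *)
Lemma sub_special P Q : special P -> Q `<=` P -> Q \top ->
  upwards_closed Q -> (forall x y m, Q x -> Q y -> is_meet x y m -> Q m) ->
  special Q.
Proof.
move=> [_ _ cP _] QP Q1 upQ meetQ; split=> //; last first.
  by move=> x y /QP + /QP; apply: cP.
by split=> [|x y _ Qy]; [exists \top | exact: upQ Qy (le_imp x y)].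
Qed.

Lemma special_setI Q R : special Q -> special R -> special (Q `&` R).
Proof.
move=> sQ sR; apply: (sub_special sQ).
- exact: subIsetl.
- by split; exact: special1.
- by move=> x y [Qx Rx] xy; split;
    [exact: special_up Qx xy | exact: special_up Rx xy].
- move=> x y m [Qx Rx] [Qy Ry] xym.
  by split; [exact: special_meet Qx Qy xym | exact: special_meet Rx Ry xym].
Qed.

Lemma special_set1 P : special P -> special [set \top : L].
Proof.
move=> sP; apply: (sub_special sP) => //.
- by move=> _ ->; exact: special1.
- by move=> x y ->; rewrite le1x => /eqP.
- by move=> x y m -> -> /is_meet11.
Qed.

Lemma special_imp_sub Q P : special_imp Q P `<=` P.
Proof. by move=> x []. Qed.

Lemma special_impS Q R P : Q `<=` R -> special_imp R P `<=` special_imp Q P.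
Proof. by move=> QR x [Px xR]; split=> // g /QR; exact: xR. Qed.

Lemma special_impI Q P x : Q x -> special_imp Q P x -> x = \top.
Proof. by move=> Qx [_ /(_ _ Qx)]; rewrite joinxx. Qed.

Lemma special_special_imp P Q : special P -> special (special_imp Q P).
Proof.
move=> sP; apply: (sub_special sP (@special_imp_sub Q P)).
- by split=> [|g _]; [exact: special1 | rewrite join1x].
- move=> x y [Px xQ] xy; split=> [|g Qg]; first exact: special_up Px xy.
  by apply/eqP; rewrite -le1x -(xQ g Qg) leU2.
- move=> x y m [Px xQ] [Py yQ] xym; split=> [|g Qg].
    exact: special_meet Px Py xym.
  (* Joining with [g] preserves the meet and sends both [x] and [y] to [\top]. *)
  by have := is_meet_join g xym; rewrite xQ// yQ// => /is_meet11.
Qed.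

Definition meets H K : set L :=
  [set m | exists h k, [/\ H h, K k & is_meet h k m]].

Lemma special_meets P H K : special P -> special H -> special K ->
  H `<=` P -> K `<=` P -> special (meets H K).
Proof.
move=> sP sH sK HP KP; apply: (sub_special sP).
- by move=> m [h [k [/HP Ph /KP Pk]]]; exact: special_meet.
- by exists \top, \top; split; [exact: special1|exact: special1|split].
(* Joining both factors of [m] with [x] gives factors of [x]. *)
- move=> m x [h [k [Hh Kk hkm]]] mx; exists (h `|` x)%O, (k `|` x)%O; split.
  + exact: special_up Hh (leUl _ _).
  + exact: special_up Kk (leUl _ _).
  + by have := is_meet_join x hkm; rewrite (join_r mx).
- move=> m n p [h [k [Hh Kk [mh mk mP]]]] [h' [k' [Hh' Kk' [nh' nk' nP]]]].
  move=> [pm pn pP].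
  (* The common lower bound [p] ensures that [h], [h'] have a meet [u] and [k], [k'] a meet [v];
     then [p] is the meet of [u] and [v]. *)
  have hh' := is_meet_imp (le_trans pm mh) (le_trans pn nh').
  have kk' := is_meet_imp (le_trans pm mk) (le_trans pn nk').
  set u := imp _ _ in hh'; set v := imp _ _ in kk'.
  exists u, v; split.
  + exact: special_meet hh'.
  + exact: special_meet kk'.
  + case: hh' kk' => [uh uh' uP] [vk vk' vP]; split.
    * by apply: uP; [exact: le_trans pm mh|exact: le_trans pn nh'].
    * by apply: vP; [exact: le_trans pm mk|exact: le_trans pn nk'].
    * move=> z zu zv; apply: pP; [apply: mP|apply: nP].
      - exact: le_trans zu uh.
      - exact: le_trans zv vk.
      - exact: le_trans zu uh'.
      - exact: le_trans zv vk'.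
Qed.

Lemma special_join_subl H K : H `<=` special_join H K.
Proof. by apply: sub_smallest; exact: subsetUl. Qed.

Lemma special_join_subr H K : K `<=` special_join H K.
Proof. by apply: sub_smallest; exact: subsetUr. Qed.

Lemma special_join_sub M H K :
  special M -> H `<=` M -> K `<=` M -> special_join H K `<=` M.
Proof. by move=> sM HM KM; apply: smallest_sub; rewrite // subUset. Qed.

Lemma special_joinE P H K : special P -> special H -> special K ->
  H `<=` P -> K `<=` P -> special_join H K = meets H K.
Proof.
move=> sP sH sK HP KP; apply/seteqP; split.
  apply: special_join_sub => [|h Hh|k Kk].
  - exact: special_meets sP _ _ _ _.
  - by exists h, \top; split=> //; exact: special1.
  - by exists \top, k; split=> //; exact: special1.
move=> m [h [k [Hh Kk hkm]]] M [sM HKM].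
by apply: (special_meet sM _ _ hkm); apply: HKM; [left|right].
Qed.

Lemma special_special_join P H K : special P -> special H -> special K ->
  H `<=` P -> K `<=` P -> special (special_join H K).
Proof.
by move=> sP sH sK HP KP; rewrite (special_joinE sP)//;
  exact: special_meets HP KP.
Qed.

(** The nontrivial half of distributivity. If [x] is the meet of [q] and [k], then [q], being above
    [x], is itself a meet of some [h] in [H] and [k'] in [K]; as [h] is above [q], it also lies in
    [Q]. *)
Lemma special_setIUl P Q H K :
  special P -> special Q -> special H -> special K ->
  Q `<=` P -> H `<=` P -> K `<=` P ->
  special_join Q K `&` special_join H K `<=` special_join (Q `&` H) K.
Proof.
move=> sP sQ sH sK QP HP KP x [].
rewrite (special_joinE sP)// => -[q [k [Qq Kk qkx]]] xHK.
have sJ := special_special_join sP sH sK HP KP.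
have [xq _ _] := qkx.
have := special_up sJ xHK xq.
rewrite (special_joinE sP)// => -[h [k' [Hh Kk' hkq]]] M [sM].
rewrite subUset => -[QHM KM].
apply: (special_meet sM _ (KM _ Kk) qkx).
apply: (special_meet sM _ (KM _ Kk') hkq).
have [qh _ _] := hkq.
by apply: QHM; split=> //; exact: special_up Qq qh.
Qed.

End Special.

(** * Closure properties of the [P]-Boolean special subalgebras *)

Section Boolean.
Context (d : Order.disp_t) (L : cubicType d) (P : set L) (sP : special P).
Implicit Types (Q R M : set L) (x : L).

(** Unfolds the join as a smallest special subalgebra; its inclusion in [P] is automatic since [P]
    is special. *)
Lemma is_booleanI Q : special Q -> Q `<=` P ->
  (forall M, special M -> Q `<=` M -> special_imp Q P `<=` M -> P `<=` M) ->
  is_boolean P Q.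
Proof.
move=> sQ QP PM; split=> //; apply/seteqP; split.
  exact: special_join_sub (@special_imp_sub _ _ _ _).
by move=> x Px M [sM]; rewrite subUset => -[QM CM]; exact: PM Px.
Qed.

Lemma is_boolean_decomp Q x : is_boolean P Q -> P x ->
  exists q r, [/\ Q q, special_imp Q P r & is_meet q r x].
Proof.
move=> [sQ QP QC]; rewrite -{1}QC (special_joinE sP)//.
- exact: special_special_imp.
- exact: special_imp_sub.
Qed.

Lemma is_boolean_set1 : is_boolean P [set \top : L].
Proof.
apply: is_booleanI; first exact: special_set1 sP.
  by move=> _ ->; exact: special1.
(* The relative complement of the singleton is all of [P]. *)
move=> M _ _ CM x Px; apply: CM; split=> // _ ->; exact: joinx1.
Qed.

Lemma is_boolean_self : is_boolean P P.
Proof. exact: is_booleanI. Qed.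

Lemma is_boolean_special_imp Q :
  is_boolean P Q -> is_boolean P (special_imp Q P).
Proof.
move=> bQ; apply: is_booleanI; first exact: special_special_imp.
  exact: special_imp_sub.
move=> M sM CM CCM x /(is_boolean_decomp bQ)[q [r [Qq Cr qrx]]].
(* The same decomposition serves, as [Q] is contained in its double relative complement. *)
apply: (special_meet sM _ (CM _ Cr) qrx); apply: CCM; split.
  by case: bQ => _ QP _; exact: QP.
by move=> g [_ gQ]; rewrite joinC gQ.
Qed.

(** Decompose [x] along [Q], then its [Q]-part [q] along [R]: the [R]-part of [q] is above [q],
    hence in both subalgebras, and relative complements are antitone. *)
Lemma is_boolean_setI Q R :
  is_boolean P Q -> is_boolean P R -> is_boolean P (Q `&` R).
Proof.
move=> bQ bR; have [sQ QP _] := bQ; have [sR RP _] := bR.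
apply: is_booleanI; first exact: special_setI.
  by move=> x [/QP].
move=> M sM QRM CM x /(is_boolean_decomp bQ)[q [r [Qq Cr qrx]]].
apply: (special_meet sM _ _ qrx).
  have [q' [r' [Rq' Cr' qr']]] := is_boolean_decomp bR (QP _ Qq).
  have [qq' _ _] := qr'.
  apply: (special_meet sM _ _ qr').
    by apply: QRM; split=> //; exact: special_up Qq qq'.
  by apply: CM; apply: special_impS Cr'; exact: subIsetr.
by apply: CM; apply: special_impS Cr; exact: subIsetl.
Qed.

Lemma special_imp_join Q R : special Q -> special R -> Q `<=` P -> R `<=` P ->
  special_imp Q P `&` special_imp R P `<=` special_imp (special_join Q R) P.
Proof.
move=> sQ sR QP RP x [[Px xQ] [_ xR]]; split=> // g.
rewrite (special_joinE sP)// => -[q [r [Qq Rr qrg]]].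
have := is_meet_join x qrg.
by rewrite ![(_ `|` x)%O]joinC xQ// xR// => /is_meet11.
Qed.

(** Dually, the part [r] of [x] in the complement of [Q] is decomposed along [R]: its last factor
    [r'] is above [r], hence in both complements. *)
Lemma is_boolean_join Q R :
  is_boolean P Q -> is_boolean P R -> is_boolean P (special_join Q R).
Proof.
move=> bQ bR; have [sQ QP _] := bQ; have [sR RP _] := bR.
apply: is_booleanI; first exact: special_special_join QP RP.
  exact: special_join_sub.
move=> M sM QRM CM x /(is_boolean_decomp bQ)[q [r [Qq Cr qrx]]].
apply: (special_meet sM _ _ qrx); first by apply: QRM; exact: special_join_subl.
have [Pr _] := Cr.
have [q' [r' [Rq' Cr' qr']]] := is_boolean_decomp bR Pr.
apply: (special_meet sM _ _ qr'); first by apply: QRM; exact: special_join_subr.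
apply: CM; apply: special_imp_join => //; split=> //.
have [_ rr' _] := qr'.
exact: (special_up (special_special_imp Q sP) Cr rr').
Qed.

(* The dependence on [sP] lets canonical structures find the proof that [P] is
   special, which the operations below need. *)
Definition boolean_special_of (_ : special P) : Type := boolean_special P.
Local Notation B := (boolean_special_of sP).
Implicit Types X Y Z : B.

(** * The order by reverse inclusion and the Boolean operations *)

HB.instance Definition _ := gen_eqMixin B.
HB.instance Definition _ := gen_choiceMixin B.

Definition bs_le X Y : bool := `[< sval Y `<=` sval X >].

Lemma bs_le_refl : reflexive bs_le.
Proof. by move=> X; exact/asboolP. Qed.

Lemma bs_le_anti : antisymmetric bs_le.
Proof.
move=> [Q bQ] [R bR] /andP[/asboolP/= RQ /asboolP/= QR].
exact/eq_exist/seteqP.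
Qed.

Lemma bs_le_trans : transitive bs_le.
Proof.
move=> Y X Z /asboolP YX /asboolP ZY; apply/asboolP; exact: subset_trans YX.
Qed.

HB.instance Definition _ := Order.Le_isPOrder.Build (Order.Disp tt tt) B
  bs_le_refl bs_le_anti bs_le_trans.

Lemma bs_leP X Y : reflect (sval Y `<=` sval X) (X <= Y)%O.
Proof. exact: asboolP. Qed.

Definition bs_meet X Y : B :=
  exist _ _ (is_boolean_join (svalP X) (svalP Y)).
Definition bs_join X Y : B :=
  exist _ _ (is_boolean_setI (svalP X) (svalP Y)).
Definition bs_top : B := exist _ _ is_boolean_set1.
Definition bs_bot : B := exist _ _ is_boolean_self.
Definition bs_compl X : B := exist _ _ (is_boolean_special_imp (svalP X)).

Lemma bs_lexI Z X Y : (Z <= bs_meet X Y)%O = (Z <= X)%O && (Z <= Y)%O.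
Proof.
apply/bs_leP/andP => /= [XYZ|[/bs_leP XZ /bs_leP YZ]].
  by split; apply/bs_leP; apply: subset_trans XYZ;
    [exact: special_join_subl|exact: special_join_subr].
by apply: special_join_sub => //; case: (svalP Z).
Qed.

Lemma bs_leUx X Y Z : (bs_join X Y <= Z)%O = (X <= Z)%O && (Y <= Z)%O.
Proof.
apply/bs_leP/andP => /=; rewrite subsetI.
  by move=> [ZX ZY]; split; apply/bs_leP.
by move=> [/bs_leP ZX /bs_leP ZY].
Qed.

HB.instance Definition _ :=
  Order.POrder_isMeetSemilattice.Build (Order.Disp tt tt) B bs_lexI.
HB.instance Definition _ :=
  Order.POrder_isJoinSemilattice.Build (Order.Disp tt tt) B bs_leUx.

Lemma bs_meetUl : @left_distributive B B Order.meet Order.join.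
Proof.
move=> X Y Z; apply: le_anti; apply/andP; split; last first.
  by rewrite leUx !leI2 ?leUl ?leUr.
have [sX XP _] := svalP X.
have [sY YP _] := svalP Y.
have [sZ ZP _] := svalP Z.
(* Under the reversed order, the remaining inequality is exactly this inclusion of sets. *)
by apply/bs_leP; exact: (special_setIUl sP).
Qed.

HB.instance Definition _ :=
  Order.Lattice_Meet_isDistrLattice.Build (Order.Disp tt tt) B bs_meetUl.

Lemma bs_le0x X : bs_bot <= X.
Proof. by apply/bs_leP; case: (svalP X). Qed.

Lemma bs_lex1 X : X <= bs_top.
Proof. by apply/bs_leP => _ ->; apply: special1; case: (svalP X). Qed.

HB.instance Definition _ :=
  Order.hasBottom.Build (Order.Disp tt tt) B bs_le0x.
HB.instance Definition _ :=
  Order.hasTop.Build (Order.Disp tt tt) B bs_lex1.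

Lemma bs_joinxC X : (X `|` bs_compl X)%O = \top.
Proof.
apply: le_anti; rewrite lex1/=; apply/bs_leP => x [Xx].
exact: special_impI.
Qed.

Lemma bs_meetxC X : (X `&` bs_compl X)%O = \bot.
(* The underlying sets agree by the definition of [is_boolean]. *)
Proof. by have [_ _ XC] := svalP X; exact/eq_exist. Qed.

HB.instance Definition _ := Order.TBDistrLattice_hasComplement.Build
  (Order.Disp tt tt) B bs_joinxC bs_meetxC.

End Boolean.

Theorem theorem7p51 (d : Order.disp_t) (L : cubicType d) (P : set L)
    (hP : special P) :
  exists c : boolean_algebra (boolean_special P),
    let B := boolean_pack c in
    let S (X : B) : set L := sval (X : boolean_special P) in
    [/\ forall X Y : B, (X <= Y)%O <-> S Y `<=` S X,
        forall X Y : B, S (X `&` Y)%O = special_join (S X) (S Y),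
        forall X Y : B, S (X `|` Y)%O = S X `&` S Y,
        S \top%O = [set \top%O] /\ S \bot%O = P
      & forall X : B, S (~` X)%O = special_imp (S X) P].
Proof.
(* [boolean_special_of hP] unfolds to [boolean_special P]. All clauses but the one on the order then
   hold by computation. *)
exists (Order.CTBDistrLattice.class (boolean_special_of hP)).
by split=> // X Y; split=> [/bs_leP|YX] //; apply/bs_leP.
Qed.
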